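(* Let $\underline R$ be an EEC computation type. For every simple type $\sigma$, $\sigma^{lv}=(\sigma^{v})^{\bullet}$ (syntactic identity of types), and consequently $\Theta^{lv}=(\Theta^v)^\bullet$ for every context $\Theta$; and for every simply-typed term $\Theta\vdash M:\sigma$, $$\Theta^{lv}\mid-\vdash M^{lv}=(M^{v})^{\bullet}:(\sigma^{lv}\Rightarrow\underline R)\multimap\underline R$$ holds in EEC.
   Context: **EEC (enriched effect calculus).** There are value-type constants $\alpha,\beta,\ldots$ and a disjoint set of computation-type constants $\underline{\alpha},\underline{\beta},\ldots$. Value types $A,B,C$ and computation types $\underline{A},\underline{B},\underline{C},\underline{D}$ are generated by $A::=\alpha\mid 1\mid A\times B\mid A\to B\mid \underline{A}\mid \underline{A}\multimap\underline{B}$ and $\underline{A}::=\underline{\alpha}\mid\underline{1}\mid\underline{A}\,\&\,\underline{B}\mid A\Rightarrow\underline{B}\mid\underline{I}\mid\ !A\mid\ !A\otimes\underline{B}\mid\underline{0}\mid\underline{A}\oplus\underline{B}$ (every computation type is also a value type; $!A\otimes\underline{B}$ is one primitive binary constructor). Judgements are $\Gamma\mid -\vdash t:A$ and $\Gamma\mid z{:}\underline{A}\vdash t:\underline{B}$, where $\Gamma$ lists distinct variables with value types and the ''stoup'' holds at most one variable, of computation type; with nonempty stoup the result type is a computation type. Below $\Delta$ is empty or $z{:}\underline{D}$. Typing rules: $\Gamma,x{:}A\mid-\vdash x:A$; $\Gamma\mid-\vdash *:1$; pairs $\langle t,u\rangle:A\times B$, projections $\pi_1t,\pi_2t$; $\lambda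 x{:}A.t:A\to B$ from $\Gamma,x{:}A\mid-\vdash t:B$; application $t\,u$ (all with empty stoup). $\Gamma\mid z{:}\underline A\vdash z:\underline A$; $\Gamma\mid\Delta\vdash\underline{*}:\underline 1$; from $\Gamma\mid\Delta\vdash t:\underline A$, $\Gamma\mid\Delta\vdash u:\underline B$ get $\Gamma\mid\Delta\vdash\langle t,u\rangle_c:\underline A\,\&\,\underline B$, and from $\Gamma\mid\Delta\vdash t:\underline A\,\&\,\underline B$ get $\underline\pi_1t:\underline A$, $\underline\pi_2t:\underline B$; from $\Gamma,x{:}A\mid\Delta\vdash t:\underline B$ get $\Gamma\mid\Delta\vdash\underline\lambda x{:}A.t:A\Rightarrow\underline B$; from $\Gamma\mid\Delta\vdash s:A\Rightarrow\underline B$, $\Gamma\mid-\vdash t:A$ get $\Gamma\mid\Delta\vdash s@t:\underline B$; $\Gamma\mid-\vdash\top:\underline I$; from $\Gamma\mid\Delta\vdash t:\underline I$, $\Gamma\mid-\vdash u:\underline A$ get $\Gamma\mid\Delta\vdash \mathrm{let}\ \top\ \mathrm{be}\ t\ \mathrm{in}\ u:\underline A$; from $\Gamma\mid-\vdash t:A$ get $\Gamma\mid-\vdash\,!t:\,!A$; from $\Gamma\mid\Delta\vdash t:\,!A$, $\Gamma,x{:}A\mid-\vdash u:\underline B$ get $\Gamma\mid\Delta\vdash\mathrm{let}\ !x\ \mathrm{be}\ t\ \mathrm{in}\ u:\underline B$; from $\Gamma\mid-\vdash t:A$, $\Gamma\mid\Delta\vdash u:\underline B$ get $\Gamma\mid\Delta\vdash\,!t\otimes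 u:\,!A\otimes\underline B$; from $\Gamma\mid\Delta\vdash s:\,!A\otimes\underline B$, $\Gamma,x{:}A\mid y{:}\underline B\vdash t:\underline C$ get $\Gamma\mid\Delta\vdash\mathrm{let}\ !x\otimes y\ \mathrm{be}\ s\ \mathrm{in}\ t:\underline C$; from $\Gamma\mid\Delta\vdash t:\underline 0$ get $\Gamma\mid\Delta\vdash\mathrm{abort}_{\underline A}(t):\underline A$; $\mathrm{inl}\,t:\underline A\oplus\underline B$ from $t:\underline A$ and $\mathrm{inr}\,t$ from $t:\underline B$ (same $\Gamma\mid\Delta$); from $\Gamma\mid\Delta\vdash s:\underline A\oplus\underline B$, $\Gamma\mid x{:}\underline A\vdash t:\underline C$, $\Gamma\mid y{:}\underline B\vdash u:\underline C$ get $\Gamma\mid\Delta\vdash\mathrm{case}\ s\ \mathrm{of}\ (\mathrm{inl}\,x\Rightarrow t\mid\mathrm{inr}\,y\Rightarrow u):\underline C$; from $\Gamma\mid z{:}\underline A\vdash t:\underline B$ get $\Gamma\mid-\vdash\hat\lambda z{:}\underline A.t:\underline A\multimap\underline B$; from $\Gamma\mid-\vdash s:\underline A\multimap\underline B$, $\Gamma\mid\Delta\vdash t:\underline A$ get $\Gamma\mid\Delta\vdash s\{t\}:\underline B$. Equality $\Gamma\mid\Delta\vdash t=u:A$ is the least typed congruence (equivalence, compatible with all term formers, containing $\alpha$-equivalence) containing all well-typed instances of: $t=*$ for $t:1$; $\pi_1\langle t,u\rangle=t$, $\pi_2\langle t,u\rangle=u$, $\langle\pi_1t,\pi_2t\rangle=t$;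 $(\lambda x.t)u=t[u/x]$, $\lambda x.(t\,x)=t$ ($x$ not free in $t$); $t=\underline*$ for $t:\underline1$; $\underline\pi_1\langle t,u\rangle_c=t$, $\underline\pi_2\langle t,u\rangle_c=u$, $\langle\underline\pi_1t,\underline\pi_2t\rangle_c=t$; $(\underline\lambda x.t)@u=t[u/x]$, $\underline\lambda x.(t@x)=t$ ($x$ not free); $\mathrm{let}\ \top\ \mathrm{be}\ \top\ \mathrm{in}\ t=t$; $\mathrm{let}\ \top\ \mathrm{be}\ t\ \mathrm{in}\ u[\top/x]=u[t/x]$ for $\Gamma\mid x{:}\underline I\vdash u:\underline A$; $\mathrm{let}\ !x\ \mathrm{be}\ !t\ \mathrm{in}\ u=u[t/x]$; $\mathrm{let}\ !x\ \mathrm{be}\ t\ \mathrm{in}\ u[!x/y]=u[t/y]$ for $\Gamma\mid y{:}\,!A\vdash u:\underline B$; $\mathrm{let}\ !x\otimes y\ \mathrm{be}\ !t\otimes s\ \mathrm{in}\ u=u[t/x,s/y]$; $\mathrm{let}\ !x\otimes y\ \mathrm{be}\ t\ \mathrm{in}\ u[(!x\otimes y)/z]=u[t/z]$ for $\Gamma\mid z{:}\,!A\otimes\underline B\vdash u:\underline C$; $\mathrm{abort}_{\underline A}(t)=u[t/x]$ for $\Gamma\mid x{:}\underline 0\vdash u:\underline A$; $\mathrm{case}\ \mathrm{inl}\,t\ \mathrm{of}\ (\mathrm{inl}\,x\Rightarrow u\mid\mathrm{inr}\,y\Rightarrow u')=u[t/x]$ and symmetrically for $\mathrm{inr}$; $\mathrm{case}\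 t\ \mathrm{of}\ (\mathrm{inl}\,x\Rightarrow u[\mathrm{inl}\,x/z]\mid\mathrm{inr}\,y\Rightarrow u[\mathrm{inr}\,y/z])=u[t/z]$ for $\Gamma\mid z{:}\underline A\oplus\underline B\vdash u:\underline C$; $(\hat\lambda x.t)\{u\}=t[u/x]$, $\hat\lambda x.(t\{x\})=t$ ($x$ not free). **Simply-typed $\lambda$-calculus.** Types $\sigma,\tau::=\alpha\mid 1\mid\sigma\times\tau\mid\sigma\to\tau$; terms $x,*,\langle M,N\rangle,\pi_1M,\pi_2M,\lambda x{:}\sigma.M,M\,N$ with standard typing in contexts $\Theta=x_1{:}\sigma_1,\ldots,x_n{:}\sigma_n$; each $\lambda$-type constant $\alpha$ is also an EEC value-type constant. **Standard cbv translation into EEC.** $\alpha^v=\alpha$, $1^v=1$, $(\sigma\times\tau)^v=\sigma^v\times\tau^v$, $(\sigma\to\tau)^v=\sigma^v\to\,!(\tau^v)$; $\Theta\vdash M:\tau$ goes to $\Theta^v\mid-\vdash M^v:\,!(\tau^v)$ with $x^v=\,!x$; $*^v=\,!*$; $\langle M,N\rangle^v=\mathrm{let}\ !x\ \mathrm{be}\ M^v\ \mathrm{in}\ \mathrm{let}\ !y\ \mathrm{be}\ N^v\ \mathrm{in}\ !\langle x,y\rangle$; $(\pi_1M)^v=\mathrm{let}\ !z\ \mathrm{be}\ M^v\ \mathrm{in}\ !(\pi_1z)$; $(\pi_2M)^v=\mathrm{let}\ !z\ \mathrm{be}\ M^v\ \mathrm{in}\ !(\pi_2z)$; $(\lambda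 x{:}\sigma.M)^v=\,!(\lambda x{:}\sigma^v.M^v)$; $(M\,N)^v=\mathrm{let}\ !f\ \mathrm{be}\ M^v\ \mathrm{in}\ \mathrm{let}\ !x\ \mathrm{be}\ N^v\ \mathrm{in}\ f\,x$. **Linear-use cbv CPS translation** (relative to $\underline R$): $\alpha^{lv}=\alpha$, $1^{lv}=1$, $(\sigma\times\tau)^{lv}=\sigma^{lv}\times\tau^{lv}$, $(\sigma\to\tau)^{lv}=\sigma^{lv}\to((\tau^{lv}\Rightarrow\underline R)\multimap\underline R)$; $\Theta^{lv}=x_1{:}\sigma_1^{lv},\ldots$; $\Theta\vdash M:\tau$ goes to $\Theta^{lv}\mid-\vdash M^{lv}:(\tau^{lv}\Rightarrow\underline R)\multimap\underline R$ with $x^{lv}=\hat\lambda k{:}\sigma^{lv}\Rightarrow\underline R.\,k@x$; $*^{lv}=\hat\lambda k{:}1\Rightarrow\underline R.\,k@*$; $\langle M,N\rangle^{lv}=\hat\lambda k{:}(\sigma^{lv}\times\tau^{lv})\Rightarrow\underline R.\,M^{lv}\{\underline\lambda x{:}\sigma^{lv}.\,N^{lv}\{\underline\lambda y{:}\tau^{lv}.\,k@\langle x,y\rangle\}\}$; $(\pi_1M)^{lv}=\hat\lambda k{:}\sigma^{lv}\Rightarrow\underline R.\,M^{lv}\{\underline\lambda z{:}\sigma^{lv}\times\tau^{lv}.\,k@(\pi_1z)\}$, $(\pi_2M)^{lv}$ analogously; $(\lambda x{:}\sigma.M)^{lv}=\hat\lambda k{:}(\sigma\to\tau)^{lv}\Rightarrow\underline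 R.\,k@(\lambda x{:}\sigma^{lv}.M^{lv})$; $(M\,N)^{lv}=\hat\lambda k{:}\tau^{lv}\Rightarrow\underline R.\,M^{lv}\{\underline\lambda f{:}(\sigma\to\tau)^{lv}.\,N^{lv}\{\underline\lambda x{:}\sigma^{lv}.\,(f\,x)\{k\}\}\}$. **Generic self-translation relative to $\underline R$.** Types: $\alpha^\bullet=\alpha$, $1^\bullet=1$, $(A\times B)^\bullet=A^\bullet\times B^\bullet$, $(A\to B)^\bullet=A^\bullet\to B^\bullet$, $\underline A^\bullet=\underline A^\circ\multimap\underline R$, $(\underline A\multimap\underline B)^\bullet=\underline B^\circ\multimap\underline A^\circ$; $\underline\alpha^\circ=\underline\alpha$ if $\underline\alpha\neq\underline R$, $=\underline I$ if $\underline R$ is the constant $\underline\alpha$; $\underline1^\circ=\underline0$; $(\underline A\&\underline B)^\circ=\underline A^\circ\oplus\underline B^\circ$; $(A\Rightarrow\underline B)^\circ=\,!(A^\bullet)\otimes\underline B^\circ$; $\underline I^\circ=\underline R$; $(!A)^\circ=A^\bullet\Rightarrow\underline R$; $(!A\otimes\underline B)^\circ=A^\bullet\Rightarrow\underline B^\circ$; $\underline0^\circ=\underline1$; $(\underline A\oplus\underline B)^\circ=\underline A^\circ\&\underline B^\circ$; $\Gamma^\bullet$ applies $(\cdot)^\bullet$ to each type. Value terms $\Gamma\mid-\vdash t:A$ go to $\Gamma^\bullet\mid-\vdash t^\bullet:A^\bullet$ and stoup terms $\Gamma\mid z{:}\underline D\vdash t:\underline B$ to $\Gamma^\bullet\mid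 k_z{:}\underline B^\circ\vdash t^\circ:\underline D^\circ$ ($k_z$ a designated fresh variable for $z$; $k,h,k_x,k_y$ fresh). Value clauses: $x^\bullet=x$; $*^\bullet=*$; $\langle t,u\rangle^\bullet=\langle t^\bullet,u^\bullet\rangle$; $(\pi_it)^\bullet=\pi_it^\bullet$; $(\lambda x{:}A.t)^\bullet=\lambda x{:}A^\bullet.t^\bullet$; $(t\,u)^\bullet=t^\bullet\,u^\bullet$; $\underline*^\bullet=\hat\lambda k{:}\underline0.\,\mathrm{abort}_{\underline R}(k)$; $\langle t,u\rangle_c^\bullet=\hat\lambda k{:}\underline A^\circ\oplus\underline B^\circ.\,\mathrm{case}\ k\ \mathrm{of}\ (\mathrm{inl}\,k_x\Rightarrow t^\bullet\{k_x\}\mid\mathrm{inr}\,k_y\Rightarrow u^\bullet\{k_y\})$; $(\underline\pi_1t)^\bullet=\hat\lambda k{:}\underline A^\circ.\,t^\bullet\{\mathrm{inl}\,k\}$; $(\underline\pi_2t)^\bullet=\hat\lambda k{:}\underline B^\circ.\,t^\bullet\{\mathrm{inr}\,k\}$; $(\underline\lambda x{:}A.t)^\bullet=\hat\lambda k{:}\,!A^\bullet\otimes\underline B^\circ.\,\mathrm{let}\ !x\otimes h\ \mathrm{be}\ k\ \mathrm{in}\ t^\bullet\{h\}$; $(s@t)^\bullet=\hat\lambda k{:}\underline B^\circ.\,s^\bullet\{!(t^\bullet)\otimes k\}$; $\top^\bullet=\hat\lambda k{:}\underline R.\,k$; $(\mathrm{let}\ \top\ \mathrm{be}\ t\ \mathrm{in}\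 u)^\bullet=\hat\lambda k{:}\underline A^\circ.\,t^\bullet\{u^\bullet\{k\}\}$; $(!t)^\bullet=\hat\lambda k{:}A^\bullet\Rightarrow\underline R.\,k@t^\bullet$; $(\mathrm{let}\ !x\ \mathrm{be}\ t\ \mathrm{in}\ u)^\bullet=\hat\lambda k{:}\underline B^\circ.\,t^\bullet\{\underline\lambda x{:}A^\bullet.\,u^\bullet\{k\}\}$; $(!t\otimes u)^\bullet=\hat\lambda k{:}A^\bullet\Rightarrow\underline B^\circ.\,u^\bullet\{k@t^\bullet\}$; $(\mathrm{let}\ !x\otimes y\ \mathrm{be}\ s\ \mathrm{in}\ t)^\bullet=\hat\lambda k{:}\underline C^\circ.\,s^\bullet\{\underline\lambda x{:}A^\bullet.\,t^\circ[k/k_y]\}$; $(\mathrm{abort}_{\underline A}(t))^\bullet=\hat\lambda k{:}\underline A^\circ.\,t^\bullet\{\underline*\}$; $(\mathrm{inl}\,t)^\bullet=\hat\lambda k{:}\underline A^\circ\&\underline B^\circ.\,t^\bullet\{\underline\pi_1k\}$; $(\mathrm{inr}\,t)^\bullet=\hat\lambda k{:}\underline A^\circ\&\underline B^\circ.\,t^\bullet\{\underline\pi_2k\}$; $(\mathrm{case}\ s\ \mathrm{of}\ (\mathrm{inl}\,x\Rightarrow t\mid\mathrm{inr}\,y\Rightarrow u))^\bullet=\hat\lambda k{:}\underline C^\circ.\,s^\bullet\{\langle t^\circ[k/k_x],u^\circ[k/k_y]\rangle_c\}$; $(\hat\lambda z{:}\underline A.t)^\bullet=\hat\lambda k{:}\underline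 B^\circ.\,t^\circ[k/k_z]$; $(s\{t\})^\bullet=\hat\lambda k{:}\underline B^\circ.\,t^\bullet\{s^\bullet\{k\}\}$. Stoup clauses: $z^\circ=k_z$; $\underline*^\circ=\mathrm{abort}_{\underline D^\circ}(k_z)$; $\langle t,u\rangle_c^\circ=\mathrm{case}\ k_z\ \mathrm{of}\ (\mathrm{inl}\,k_x\Rightarrow t^\circ[k_x/k_z]\mid\mathrm{inr}\,k_y\Rightarrow u^\circ[k_y/k_z])$; $(\underline\pi_1t)^\circ=t^\circ[\mathrm{inl}\,k_z/k_z]$; $(\underline\pi_2t)^\circ=t^\circ[\mathrm{inr}\,k_z/k_z]$; $(\underline\lambda x{:}A.t)^\circ=\mathrm{let}\ !x\otimes h\ \mathrm{be}\ k_z\ \mathrm{in}\ t^\circ[h/k_z]$; $(s@t)^\circ=s^\circ[(!(t^\bullet)\otimes k_z)/k_z]$; $(\mathrm{let}\ \top\ \mathrm{be}\ t\ \mathrm{in}\ u)^\circ=t^\circ[u^\bullet\{k_z\}/k_z]$; $(\mathrm{let}\ !x\ \mathrm{be}\ t\ \mathrm{in}\ u)^\circ=t^\circ[(\underline\lambda x{:}A^\bullet.\,u^\bullet\{k_z\})/k_z]$; $(!t\otimes u)^\circ=u^\circ[(k_z@t^\bullet)/k_z]$; $(\mathrm{let}\ !x\otimes y\ \mathrm{be}\ s\ \mathrm{in}\ t)^\circ=s^\circ[(\underline\lambda x{:}A^\bullet.\,t^\circ[k_z/k_y])/k_z]$; $(\mathrm{abort}(t))^\circ=t^\circ[\underline*/k_z]$;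 $(\mathrm{inl}\,t)^\circ=t^\circ[\underline\pi_1k_z/k_z]$; $(\mathrm{inr}\,t)^\circ=t^\circ[\underline\pi_2k_z/k_z]$; $(\mathrm{case}\ s\ \mathrm{of}\ (\mathrm{inl}\,x\Rightarrow t\mid\mathrm{inr}\,y\Rightarrow u))^\circ=s^\circ[\langle t^\circ[k_z/k_x],u^\circ[k_z/k_y]\rangle_c/k_z]$; $(s\{t\})^\circ=t^\circ[s^\bullet\{k_z\}/k_z]$. *)

(* Defs.v *)
From mathcomp Require Import all_boot.

Set Implicit Arguments.
Unset Strict Implicit.
Unset Printing Implicit Defensive.

(* Terms are intrinsically typed and nameless: a term is identified with its
   typing derivation and alpha-equivalence is syntactic identity.  A context is
   a sequence of types whose head is the most recently bound variable. *)
Inductive var {X : Type} : seq X -> X -> Type :=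
| VZ G A : var (A :: G) A
| VS G A B : var G A -> var (B :: G) A.

Arguments VZ {X G A}.
Arguments VS {X G A B} x.

Fixpoint var_map (X Y : Type) (f : X -> Y) (G : seq X) (A : X) (x : var G A)
    : var (map f G) (f A) :=
  match x in var G0 A0 return var (map f G0) (f A0) with
  | VZ _ _ => VZ
  | VS _ _ _ y => VS (var_map f y)
  end.

Definition lift_ren (X : Type) (G G' : seq X)
    (r : forall A, var G A -> var G' A) (B : X)
    : forall A, var (B :: G) A -> var (B :: G') A :=
  fun A x =>
    match x in var G0 A0
      return match G0 with
             | [::] => unit
             | B0 :: G1 => (forall A, var G1 A -> var G' A) -> var (B0 :: G') A0
             end with
    | VZ _ _ => fun _ => VZ
    | VS _ _ _ y => fun r => VS (r _ y)
    end r.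

(* Enriched effect calculus: types over value-type constants [vc] and
   computation-type constants [cc]. *)
Inductive vty (vc cc : Type) : Type :=
| VConst of vc
| VOne
| VProd of vty vc cc & vty vc cc
| VArr of vty vc cc & vty vc cc            (* A -> B *)
| VComp of cty vc cc                       (* a computation type as a value type *)
| VLin of cty vc cc & cty vc cc            (* A -o B *)
with cty (vc cc : Type) : Type :=
| CConst of cc
| COne
| CWith of cty vc cc & cty vc cc           (* A & B *)
| CPow of vty vc cc & cty vc cc            (* A => B *)
| CUnit                                    (* I *)
| CBang of vty vc cc                       (* !A *)
| CTens of vty vc cc & cty vc cc           (* !A (x) B, a primitive constructor *)
| CZero
| CPlus of cty vc cc & cty vc cc.          (* A (+) B *)

Arguments VConst {vc cc} _.
Arguments VOne {vc cc}.
Arguments VComp {vc cc} _.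
Arguments CConst {vc cc} _.
Arguments COne {vc cc}.
Arguments CUnit {vc cc}.
Arguments CZero {vc cc}.

Section Terms.
Context {vc cc : Type}.
Local Notation vty := (vty vc cc).
Local Notation cty := (cty vc cc).
Local Notation ctx := (seq vty).
Local Notation stoup := (option cty).

(* [tm G S A]: derivable judgements G | S |- t : A. *)
Inductive tm : ctx -> stoup -> vty -> Type :=
| Var G A : var G A -> tm G None A
| Star G : tm G None VOne
| Pair G A B : tm G None A -> tm G None B -> tm G None (VProd A B)
| Fst G A B : tm G None (VProd A B) -> tm G None A
| Snd G A B : tm G None (VProd A B) -> tm G None B
| Lam G A B : tm (A :: G) None B -> tm G None (VArr A B)
| App G A B : tm G None (VArr A B) -> tm G None A -> tm G None B
(* the stoup variable *)
| SVar G A : tm G (Some A) (VComp A)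
| CStar G S : tm G S (VComp COne)
| CPair G S A B : tm G S (VComp A) -> tm G S (VComp B) ->
    tm G S (VComp (CWith A B))
| CFst G S A B : tm G S (VComp (CWith A B)) -> tm G S (VComp A)
| CSnd G S A B : tm G S (VComp (CWith A B)) -> tm G S (VComp B)
(* \underline\lambda x:A. t  and  s @ t *)
| CLam G S A B : tm (A :: G) S (VComp B) -> tm G S (VComp (CPow A B))
| CApp G S A B : tm G S (VComp (CPow A B)) -> tm G None A -> tm G S (VComp B)
| Top G : tm G None (VComp CUnit)
| LetTop G S A : tm G S (VComp CUnit) -> tm G None (VComp A) -> tm G S (VComp A)
| Bang G A : tm G None A -> tm G None (VComp (CBang A))
| LetBang G S A B : tm G S (VComp (CBang A)) -> tm (A :: G) None (VComp B) ->
    tm G S (VComp B)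
(* !t (x) u  and  let !x (x) y be s in t *)
| Tens G S A B : tm G None A -> tm G S (VComp B) -> tm G S (VComp (CTens A B))
| LetTens G S A B C : tm G S (VComp (CTens A B)) ->
    tm (A :: G) (Some B) (VComp C) -> tm G S (VComp C)
| Abort G S A : tm G S (VComp CZero) -> tm G S (VComp A)
| Inl G S A B : tm G S (VComp A) -> tm G S (VComp (CPlus A B))
| Inr G S A B : tm G S (VComp B) -> tm G S (VComp (CPlus A B))
| Case G S A B C : tm G S (VComp (CPlus A B)) ->
    tm G (Some A) (VComp C) -> tm G (Some B) (VComp C) -> tm G S (VComp C)
(* \hat\lambda z:A. t  and  s{t} *)
| LLam G A B : tm G (Some A) (VComp B) -> tm G None (VLin A B)
| LApp G S A B : tm G None (VLin A B) -> tm G S (VComp A) -> tm G S (VComp B).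

Definition vren (G G' : ctx) := forall A, var G A -> var G' A.

Fixpoint ren G S T (t : tm G S T) : forall G', vren G G' -> tm G' S T :=
  match t in tm G0 S0 T0 return forall G', vren G0 G' -> tm G' S0 T0 with
  | Var _ _ x => fun _ r => Var (r _ x)
  | Star _ => fun _ _ => Star _
  | Pair _ _ _ t u => fun _ r => Pair (ren t r) (ren u r)
  | Fst _ _ _ t => fun _ r => Fst (ren t r)
  | Snd _ _ _ t => fun _ r => Snd (ren t r)
  | Lam _ _ _ t => fun _ r => Lam (ren t (lift_ren r (B := _)))
  | App _ _ _ t u => fun _ r => App (ren t r) (ren u r)
  | SVar _ _ => fun _ _ => SVar _ _
  | CStar _ _ => fun _ _ => CStar _ _
  | CPair _ _ _ _ t u => fun _ r => CPair (ren t r) (ren u r)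
  | CFst _ _ _ _ t => fun _ r => CFst (ren t r)
  | CSnd _ _ _ _ t => fun _ r => CSnd (ren t r)
  | CLam _ _ _ _ t => fun _ r => CLam (ren t (lift_ren r (B := _)))
  | CApp _ _ _ _ s t => fun _ r => CApp (ren s r) (ren t r)
  | Top _ => fun _ _ => Top _
  | LetTop _ _ _ t u => fun _ r => LetTop (ren t r) (ren u r)
  | Bang _ _ t => fun _ r => Bang (ren t r)
  | LetBang _ _ _ _ t u =>
      fun _ r => LetBang (ren t r) (ren u (lift_ren r (B := _)))
  | Tens _ _ _ _ t u => fun _ r => Tens (ren t r) (ren u r)
  | LetTens _ _ _ _ _ s t =>
      fun _ r => LetTens (ren s r) (ren t (lift_ren r (B := _)))
  | Abort _ _ _ t => fun _ r => Abort _ (ren t r)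
  | Inl _ _ _ _ t => fun _ r => Inl _ (ren t r)
  | Inr _ _ _ _ t => fun _ r => Inr _ (ren t r)
  | Case _ _ _ _ _ s t u => fun _ r => Case (ren s r) (ren t r) (ren u r)
  | LLam _ _ _ t => fun _ r => LLam (ren t r)
  | LApp _ _ _ _ s t => fun _ r => LApp (ren s r) (ren t r)
  end.

Definition wk G S T B (t : tm G S T) : tm (B :: G) S T :=
  ren t (fun _ => VS).

Definition vsub (G G' : ctx) := forall A, var G A -> tm G' None A.

Definition id_vsub G : vsub G G := fun _ x => Var x.

Definition cons_vsub G G' B (t : tm G' None B) (s : vsub G G')
    : vsub (B :: G) G' :=
  fun A x =>
    match x in var G0 A0
      return match G0 with
             | [::] => unit
             | B0 :: G1 => tm G' None B0 -> vsub G1 G' -> tm G' None A0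
             end with
    | VZ _ _ => fun t _ => t
    | VS _ _ _ y => fun _ s => s _ y
    end t s.

Definition lift_vsub G G' (s : vsub G G') B : vsub (B :: G) (B :: G') :=
  cons_vsub (Var VZ) (fun A x => wk B (s A x)).

(* [ssub G S S']: what replaces the stoup variable when passing from stoup [S]
   to stoup [S']; an empty stoup stays empty. *)
Inductive ssub (G : ctx) : stoup -> stoup -> Type :=
| SNone : ssub G None None
| SSome A S' : tm G S' (VComp A) -> ssub G (Some A) S'.

Definition id_ssub G S : ssub G S S :=
  match S with
  | None => SNone G
  | Some A => SSome (SVar G A)
  end.

Definition wk_ssub G S S' B (d : ssub G S S') : ssub (B :: G) S S' :=
  match d in ssub _ S0 S0' return ssub (B :: G) S0 S0' with
  | SNone => SNone _
  | SSome _ _ t => SSome (wk B t)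
  end.

Definition keep_none G S' T (d : ssub G None S') (t : tm G None T)
    : tm G S' T :=
  match d in ssub _ S0 S0'
    return match S0 with
           | None => tm G None T -> tm G S0' T
           | Some _ => unit
           end with
  | SNone => fun t => t
  | SSome _ _ _ => tt
  end t.

Definition ssub_tm G A S' (d : ssub G (Some A) S') : tm G S' (VComp A) :=
  match d in ssub _ S0 S0'
    return match S0 with
           | None => unit
           | Some A0 => tm G S0' (VComp A0)
           end with
  | SNone => tt
  | SSome _ _ t => t
  end.

(* Simultaneous capture-avoiding substitution for the context variables and
   the stoup variable. *)
Fixpoint subst G S T (t : tm G S T)
    : forall G' S', vsub G G' -> ssub G' S S' -> tm G' S' T :=
  match t in tm G0 S0 T0
    return forall G' S', vsub G0 G' -> ssub G' S0 S' -> tm G' S' T0 with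
  | Var _ _ x => fun _ _ s d => keep_none d (s _ x)
  | Star _ => fun _ _ s d => keep_none d (Star _)
  | Pair _ _ _ t u => fun _ _ s d =>
      keep_none d (Pair (subst t s (SNone _)) (subst u s (SNone _)))
  | Fst _ _ _ t => fun _ _ s d => keep_none d (Fst (subst t s (SNone _)))
  | Snd _ _ _ t => fun _ _ s d => keep_none d (Snd (subst t s (SNone _)))
  | Lam _ _ _ t => fun _ _ s d =>
      keep_none d (Lam (subst t (lift_vsub s (B := _)) (SNone _)))
  | App _ _ _ t u => fun _ _ s d =>
      keep_none d (App (subst t s (SNone _)) (subst u s (SNone _)))
  | SVar _ _ => fun _ _ s d => ssub_tm d
  | CStar _ _ => fun _ _ s d => CStar _ _
  | CPair _ _ _ _ t u => fun _ _ s d => CPair (subst t s d) (subst u s d)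
  | CFst _ _ _ _ t => fun _ _ s d => CFst (subst t s d)
  | CSnd _ _ _ _ t => fun _ _ s d => CSnd (subst t s d)
  | CLam _ _ _ _ t => fun _ _ s d =>
      CLam (subst t (lift_vsub s (B := _)) (wk_ssub _ d))
  | CApp _ _ _ _ t u => fun _ _ s d =>
      CApp (subst t s d) (subst u s (SNone _))
  | Top _ => fun _ _ s d => keep_none d (Top _)
  | LetTop _ _ _ t u => fun _ _ s d =>
      LetTop (subst t s d) (subst u s (SNone _))
  | Bang _ _ t => fun _ _ s d => keep_none d (Bang (subst t s (SNone _)))
  | LetBang _ _ _ _ t u => fun _ _ s d =>
      LetBang (subst t s d) (subst u (lift_vsub s (B := _)) (SNone _))
  | Tens _ _ _ _ t u => fun _ _ s d =>
      Tens (subst t s (SNone _)) (subst u s d)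
  | LetTens _ _ _ _ _ t u => fun _ _ s d =>
      LetTens (subst t s d) (subst u (lift_vsub s (B := _)) (id_ssub _ _))
  | Abort _ _ _ t => fun _ _ s d => Abort _ (subst t s d)
  | Inl _ _ _ _ t => fun _ _ s d => Inl _ (subst t s d)
  | Inr _ _ _ _ t => fun _ _ s d => Inr _ (subst t s d)
  | Case _ _ _ _ _ t u v => fun _ _ s d =>
      Case (subst t s d) (subst u s (id_ssub _ _)) (subst v s (id_ssub _ _))
  | LLam _ _ _ t => fun _ _ s d =>
      keep_none d (LLam (subst t s (id_ssub _ _)))
  | LApp _ _ _ _ t u => fun _ _ s d =>
      LApp (subst t s (SNone _)) (subst u s d)
  end.

(* t[u/x] for a context variable x *)
Definition vsubst1 G S A T (t : tm (A :: G) S T) (u : tm G None A) : tm G S T :=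
  subst t (cons_vsub u (id_vsub (G := G))) (id_ssub G S).

(* t[u/z] for the stoup variable z *)
Definition ssubst1 G S A T (t : tm G (Some A) T) (u : tm G S (VComp A))
    : tm G S T :=
  subst t (id_vsub (G := G)) (SSome u).

(* t[u/x, v/z] *)
Definition vssubst1 G S A B T (t : tm (A :: G) (Some B) T)
    (u : tm G None A) (v : tm G S (VComp B)) : tm G S T :=
  subst t (cons_vsub u (id_vsub (G := G))) (SSome v).

Inductive eqtm : forall G S T, tm G S T -> tm G S T -> Prop :=
| eqtm_refl G S T (t : tm G S T) : eqtm t t
| eqtm_sym G S T (t u : tm G S T) : eqtm t u -> eqtm u t
| eqtm_trans G S T (t u v : tm G S T) : eqtm t u -> eqtm u v -> eqtm t v
(* compatibility with the term formers; the nullary ones are covered by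
   reflexivity *)
| cong_Pair G A B (t t' : tm G None A) (u u' : tm G None B) :
    eqtm t t' -> eqtm u u' -> eqtm (Pair t u) (Pair t' u')
| cong_Fst G A B (t t' : tm G None (VProd A B)) :
    eqtm t t' -> eqtm (Fst t) (Fst t')
| cong_Snd G A B (t t' : tm G None (VProd A B)) :
    eqtm t t' -> eqtm (Snd t) (Snd t')
| cong_Lam G A B (t t' : tm (A :: G) None B) :
    eqtm t t' -> eqtm (Lam t) (Lam t')
| cong_App G A B (t t' : tm G None (VArr A B)) (u u' : tm G None A) :
    eqtm t t' -> eqtm u u' -> eqtm (App t u) (App t' u')
| cong_CPair G S A B (t t' : tm G S (VComp A)) (u u' : tm G S (VComp B)) :
    eqtm t t' -> eqtm u u' -> eqtm (CPair t u) (CPair t' u')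
| cong_CFst G S A B (t t' : tm G S (VComp (CWith A B))) :
    eqtm t t' -> eqtm (CFst t) (CFst t')
| cong_CSnd G S A B (t t' : tm G S (VComp (CWith A B))) :
    eqtm t t' -> eqtm (CSnd t) (CSnd t')
| cong_CLam G S A B (t t' : tm (A :: G) S (VComp B)) :
    eqtm t t' -> eqtm (CLam t) (CLam t')
| cong_CApp G S A B (t t' : tm G S (VComp (CPow A B))) (u u' : tm G None A) :
    eqtm t t' -> eqtm u u' -> eqtm (CApp t u) (CApp t' u')
| cong_LetTop G S A (t t' : tm G S (VComp CUnit)) (u u' : tm G None (VComp A)) :
    eqtm t t' -> eqtm u u' -> eqtm (LetTop t u) (LetTop t' u')
| cong_Bang G A (t t' : tm G None A) :
    eqtm t t' -> eqtm (Bang t) (Bang t')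
| cong_LetBang G S A B (t t' : tm G S (VComp (CBang A)))
    (u u' : tm (A :: G) None (VComp B)) :
    eqtm t t' -> eqtm u u' -> eqtm (LetBang t u) (LetBang t' u')
| cong_Tens G S A B (t t' : tm G None A) (u u' : tm G S (VComp B)) :
    eqtm t t' -> eqtm u u' -> eqtm (Tens t u) (Tens t' u')
| cong_LetTens G S A B C (t t' : tm G S (VComp (CTens A B)))
    (u u' : tm (A :: G) (Some B) (VComp C)) :
    eqtm t t' -> eqtm u u' -> eqtm (LetTens t u) (LetTens t' u')
| cong_Abort G S A (t t' : tm G S (VComp CZero)) :
    eqtm t t' -> eqtm (Abort A t) (Abort A t')
| cong_Inl G S A B (t t' : tm G S (VComp A)) :
    eqtm t t' -> eqtm (Inl B t) (Inl B t')
| cong_Inr G S A B (t t' : tm G S (VComp B)) :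
    eqtm t t' -> eqtm (Inr A t) (Inr A t')
| cong_Case G S A B C (t t' : tm G S (VComp (CPlus A B)))
    (u u' : tm G (Some A) (VComp C)) (v v' : tm G (Some B) (VComp C)) :
    eqtm t t' -> eqtm u u' -> eqtm v v' -> eqtm (Case t u v) (Case t' u' v')
| cong_LLam G A B (t t' : tm G (Some A) (VComp B)) :
    eqtm t t' -> eqtm (LLam t) (LLam t')
| cong_LApp G S A B (t t' : tm G None (VLin A B)) (u u' : tm G S (VComp A)) :
    eqtm t t' -> eqtm u u' -> eqtm (LApp t u) (LApp t' u')
(* axioms *)
| eta_Star G (t : tm G None VOne) : eqtm t (Star G)
| beta_Fst G A B (t : tm G None A) (u : tm G None B) : eqtm (Fst (Pair t u)) t
| beta_Snd G A B (t : tm G None A) (u : tm G None B) : eqtm (Snd (Pair t u)) u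
| eta_Pair G A B (t : tm G None (VProd A B)) : eqtm (Pair (Fst t) (Snd t)) t
| beta_Lam G A B (t : tm (A :: G) None B) (u : tm G None A) :
    eqtm (App (Lam t) u) (vsubst1 t u)
| eta_Lam G A B (t : tm G None (VArr A B)) :
    eqtm (Lam (App (wk A t) (Var VZ))) t
| eta_CStar G S (t : tm G S (VComp COne)) : eqtm t (CStar G S)
| beta_CFst G S A B (t : tm G S (VComp A)) (u : tm G S (VComp B)) :
    eqtm (CFst (CPair t u)) t
| beta_CSnd G S A B (t : tm G S (VComp A)) (u : tm G S (VComp B)) :
    eqtm (CSnd (CPair t u)) u
| eta_CPair G S A B (t : tm G S (VComp (CWith A B))) :
    eqtm (CPair (CFst t) (CSnd t)) t
| beta_CLam G S A B (t : tm (A :: G) S (VComp B)) (u : tm G None A) :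
    eqtm (CApp (CLam t) u) (vsubst1 t u)
| eta_CLam G S A B (t : tm G S (VComp (CPow A B))) :
    eqtm (CLam (CApp (wk A t) (Var VZ))) t
| beta_Top G A (t : tm G None (VComp A)) : eqtm (LetTop (Top G) t) t
| eta_Top G S A (t : tm G S (VComp CUnit)) (u : tm G (Some CUnit) (VComp A)) :
    eqtm (LetTop t (ssubst1 u (Top G))) (ssubst1 u t)
| beta_Bang G A B (t : tm G None A) (u : tm (A :: G) None (VComp B)) :
    eqtm (LetBang (Bang t) u) (vsubst1 u t)
| eta_Bang G S A B (t : tm G S (VComp (CBang A)))
    (u : tm G (Some (CBang A)) (VComp B)) :
    eqtm (LetBang t (ssubst1 (wk A u) (Bang (Var VZ)))) (ssubst1 u t)
| beta_Tens G S A B C (t : tm G None A) (s : tm G S (VComp B))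
    (u : tm (A :: G) (Some B) (VComp C)) :
    eqtm (LetTens (Tens t s) u) (vssubst1 u t s)
| eta_Tens G S A B C (t : tm G S (VComp (CTens A B)))
    (u : tm G (Some (CTens A B)) (VComp C)) :
    eqtm (LetTens t (ssubst1 (wk A u) (Tens (Var VZ) (SVar (A :: G) B))))
         (ssubst1 u t)
| eta_Zero G S A (t : tm G S (VComp CZero)) (u : tm G (Some CZero) (VComp A)) :
    eqtm (Abort A t) (ssubst1 u t)
| beta_Inl G S A B C (t : tm G S (VComp A))
    (u : tm G (Some A) (VComp C)) (v : tm G (Some B) (VComp C)) :
    eqtm (Case (Inl B t) u v) (ssubst1 u t)
| beta_Inr G S A B C (t : tm G S (VComp B))
    (u : tm G (Some A) (VComp C)) (v : tm G (Some B) (VComp C)) :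
    eqtm (Case (Inr A t) u v) (ssubst1 v t)
| eta_Case G S A B C (t : tm G S (VComp (CPlus A B)))
    (u : tm G (Some (CPlus A B)) (VComp C)) :
    eqtm (Case t (ssubst1 u (Inl B (SVar G A))) (ssubst1 u (Inr A (SVar G B))))
         (ssubst1 u t)
| beta_LLam G S A B (t : tm G (Some A) (VComp B)) (u : tm G S (VComp A)) :
    eqtm (LApp (LLam t) u) (ssubst1 t u)
| eta_LLam G A B (t : tm G None (VLin A B)) :
    eqtm (LLam (LApp t (SVar G A))) t.

(* Reads a judgement over [G'] and [A'] at the equal context [G] and type [A]. *)
Definition cast_tm G G' S A A' (eG : G = G') (eA : A = A') (t : tm G' S A')
    : tm G S A :=
  match esym eG in _ = G0 return tm G0 S A with
  | erefl => match esym eA in _ = A0 return tm G' S A0 with erefl => t end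
  end.

End Terms.

(* Simply-typed lambda-calculus over the EEC value-type constants. *)
Inductive sty (vc : Type) : Type :=
| SConst of vc
| SOne
| SProd of sty vc & sty vc
| SArr of sty vc & sty vc.

Arguments SOne {vc}.

Inductive stm (vc : Type) : seq (sty vc) -> sty vc -> Type :=
| LVar G a : var G a -> stm G a
| LStar G : stm G SOne
| LPair G a b : stm G a -> stm G b -> stm G (SProd a b)
| LFst G a b : stm G (SProd a b) -> stm G a
| LSnd G a b : stm G (SProd a b) -> stm G b
| LAbs G a b : stm (a :: G) b -> stm G (SArr a b)
| LAp G a b : stm G (SArr a b) -> stm G a -> stm G b.

Section StandardCbv.
Context {vc cc : Type}.

Fixpoint v_ty (a : sty vc) : vty vc cc :=
  match a with
  | SConst c => VConst c
  | SOne => VOne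
  | SProd a b => VProd (v_ty a) (v_ty b)
  | SArr a b => VArr (v_ty a) (VComp (CBang (v_ty b)))
  end.

Definition v_ctx (Th : seq (sty vc)) : seq (vty vc cc) := map v_ty Th.

Fixpoint v_tm Th a (M : stm Th a) : tm (v_ctx Th) None (VComp (CBang (v_ty a))) :=
  match M in stm Th0 a0
    return tm (v_ctx Th0) None (VComp (CBang (v_ty a0))) with
  | LVar _ _ x => Bang (Var (var_map v_ty x))
  | LStar _ => Bang (Star _)
  | LPair _ _ _ M N =>
      LetBang (v_tm M) (LetBang (wk _ (v_tm N))
        (Bang (Pair (Var (VS VZ)) (Var VZ))))
  | LFst _ _ _ M => LetBang (v_tm M) (Bang (Fst (Var VZ)))
  | LSnd _ _ _ M => LetBang (v_tm M) (Bang (Snd (Var VZ)))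
  | LAbs _ _ _ M => Bang (Lam (v_tm M))
  | LAp _ _ _ M N =>
      LetBang (v_tm M) (LetBang (wk _ (v_tm N))
        (App (Var (VS VZ)) (Var VZ)))
  end.

End StandardCbv.

Section LinearCps.
Context {vc cc : Type} (R : cty vc cc).

Definition cont (A : vty vc cc) : vty vc cc := VLin (CPow A R) R.

Fixpoint lv_ty (a : sty vc) : vty vc cc :=
  match a with
  | SConst c => VConst c
  | SOne => VOne
  | SProd a b => VProd (lv_ty a) (lv_ty b)
  | SArr a b => VArr (lv_ty a) (cont (lv_ty b))
  end.

Definition lv_ctx (Th : seq (sty vc)) : seq (vty vc cc) := map lv_ty Th.

(* [SVar _ _] is the continuation k, bound by the enclosing [LLam]. *)
Fixpoint lv_tm Th a (M : stm Th a) : tm (lv_ctx Th) None (cont (lv_ty a)) :=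
  match M in stm Th0 a0 return tm (lv_ctx Th0) None (cont (lv_ty a0)) with
  | LVar _ _ x => LLam (CApp (SVar _ _) (Var (var_map lv_ty x)))
  | LStar _ => LLam (CApp (SVar _ _) (Star _))
  | LPair _ _ _ M N =>
      LLam (LApp (lv_tm M) (CLam (LApp (wk _ (lv_tm N)) (CLam
        (CApp (SVar _ _) (Pair (Var (VS VZ)) (Var VZ)))))))
  | LFst _ _ _ M =>
      LLam (LApp (lv_tm M) (CLam (CApp (SVar _ _) (Fst (Var VZ)))))
  | LSnd _ _ _ M =>
      LLam (LApp (lv_tm M) (CLam (CApp (SVar _ _) (Snd (Var VZ)))))
  | LAbs _ _ _ M => LLam (CApp (SVar _ _) (Lam (lv_tm M)))
  | LAp _ _ _ M N =>
      LLam (LApp (lv_tm M) (CLam (LApp (wk _ (lv_tm N)) (CLam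
        (LApp (App (Var (VS VZ)) (Var VZ)) (SVar _ _))))))
  end.

End LinearCps.

Section SelfTranslation.
Context {vc : Type} {cc : eqType} (R : cty vc cc).

Fixpoint bul_ty (A : vty vc cc) : vty vc cc :=
  match A with
  | VConst c => VConst c
  | VOne => VOne
  | VProd A B => VProd (bul_ty A) (bul_ty B)
  | VArr A B => VArr (bul_ty A) (bul_ty B)
  | VComp A => VLin (circ_ty A) R
  | VLin A B => VLin (circ_ty B) (circ_ty A)
  end
with circ_ty (A : cty vc cc) : cty vc cc :=
  match A with
  | CConst c =>
      if (if R is CConst r then c == r else false) then CUnit else CConst c
  | COne => CZero
  | CWith A B => CPlus (circ_ty A) (circ_ty B)
  | CPow A B => CTens (bul_ty A) (circ_ty B)
  | CUnit => R
  | CBang A => CPow (bul_ty A) R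
  | CTens A B => CPow (bul_ty A) (circ_ty B)
  | CZero => COne
  | CPlus A B => CWith (circ_ty A) (circ_ty B)
  end.

Definition bul_ctx (G : seq (vty vc cc)) : seq (vty vc cc) := map bul_ty G.

(* Type of the translation of a judgement G | S |- t : T.  No judgement has a
   nonempty stoup and a result type that is not a computation type, so the
   [unit] branch is never used. *)
Definition trans_ty G S T : Type :=
  match S with
  | None => tm (bul_ctx G) None (bul_ty T)
  | Some D =>
      match T with
      | VComp B => tm (bul_ctx G) (Some (circ_ty B)) (VComp (circ_ty D))
      | _ => unit
      end
  end.

(* The value translation (empty stoup) and the stoup translation (nonempty
   stoup), in one recursion over derivations.  [SVar _ _] is k, h, k_x, k_y or
   k_z according to the innermost binder of the stoup, so renamings such as
   t°[k/k_y] of the stoup variable are the identity. *)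
Fixpoint trans G S T (t : tm G S T) : trans_ty G S T :=
  match t in tm G0 S0 T0 return trans_ty G0 S0 T0 with
  | Var _ _ x => Var (var_map bul_ty x)
  | Star _ => Star _
  | Pair _ _ _ t u => Pair (trans t) (trans u)
  | Fst _ _ _ t => Fst (trans t)
  | Snd _ _ _ t => Snd (trans t)
  | Lam _ _ _ t => Lam (trans t)
  | App _ _ _ t u => App (trans t) (trans u)
  | SVar _ _ => SVar _ _
  | CStar G St =>
      match St return trans_ty G St (VComp COne) with
      | None => LLam (Abort _ (SVar _ _))
      | Some _ => Abort _ (SVar _ _)
      end
  | CPair G St A B t u =>
      match St return trans_ty G St (VComp A) -> trans_ty G St (VComp B) ->
                     trans_ty G St (VComp (CWith A B)) with
      | None => fun t u =>
          LLam (Case (SVar _ _) (LApp t (SVar _ _)) (LApp u (SVar _ _)))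
      | Some _ => fun t u => Case (SVar _ _) t u
      end (trans t) (trans u)
  | CFst G St A B t =>
      match St return trans_ty G St (VComp (CWith A B)) ->
                     trans_ty G St (VComp A) with
      | None => fun t => LLam (LApp t (Inl _ (SVar _ _)))
      | Some _ => fun t => ssubst1 t (Inl _ (SVar _ _))
      end (trans t)
  | CSnd G St A B t =>
      match St return trans_ty G St (VComp (CWith A B)) ->
                     trans_ty G St (VComp B) with
      | None => fun t => LLam (LApp t (Inr _ (SVar _ _)))
      | Some _ => fun t => ssubst1 t (Inr _ (SVar _ _))
      end (trans t)
  | CLam G St A B t =>
      match St return trans_ty (A :: G) St (VComp B) ->
                     trans_ty G St (VComp (CPow A B)) with
      | None => fun t => LLam (LetTens (SVar _ _) (LApp t (SVar _ _)))
      | Some _ => fun t => LetTens (SVar _ _) t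
      end (trans t)
  | CApp G St A B s t =>
      match St return trans_ty G St (VComp (CPow A B)) -> trans_ty G None A ->
                     trans_ty G St (VComp B) with
      | None => fun s t => LLam (LApp s (Tens t (SVar _ _)))
      | Some _ => fun s t => ssubst1 s (Tens t (SVar _ _))
      end (trans s) (trans t)
  | Top _ => LLam (SVar _ _)
  | LetTop G St A t u =>
      match St return trans_ty G St (VComp CUnit) -> trans_ty G None (VComp A) ->
                     trans_ty G St (VComp A) with
      | None => fun t u => LLam (LApp t (LApp u (SVar _ _)))
      | Some _ => fun t u => ssubst1 t (LApp u (SVar _ _))
      end (trans t) (trans u)
  | Bang _ _ t => LLam (CApp (SVar _ _) (trans t))
  | LetBang G St A B t u =>
      match St return trans_ty G St (VComp (CBang A)) ->
                     trans_ty (A :: G) None (VComp B) ->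
                     trans_ty G St (VComp B) with
      | None => fun t u => LLam (LApp t (CLam (LApp u (SVar _ _))))
      | Some _ => fun t u => ssubst1 t (CLam (LApp u (SVar _ _)))
      end (trans t) (trans u)
  | Tens G St A B t u =>
      match St return trans_ty G None A -> trans_ty G St (VComp B) ->
                     trans_ty G St (VComp (CTens A B)) with
      | None => fun t u => LLam (LApp u (CApp (SVar _ _) t))
      | Some _ => fun t u => ssubst1 u (CApp (SVar _ _) t)
      end (trans t) (trans u)
  | LetTens G St A B C s t =>
      match St return trans_ty G St (VComp (CTens A B)) ->
                     trans_ty (A :: G) (Some B) (VComp C) ->
                     trans_ty G St (VComp C) with
      | None => fun s t => LLam (LApp s (CLam t))
      | Some _ => fun s t => ssubst1 s (CLam t)
      end (trans s) (trans t)
  | Abort G St A t =>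
      match St return trans_ty G St (VComp CZero) -> trans_ty G St (VComp A) with
      | None => fun t => LLam (LApp t (CStar _ _))
      | Some _ => fun t => ssubst1 t (CStar _ _)
      end (trans t)
  | Inl G St A B t =>
      match St return trans_ty G St (VComp A) ->
                     trans_ty G St (VComp (CPlus A B)) with
      | None => fun t => LLam (LApp t (CFst (SVar _ _)))
      | Some _ => fun t => ssubst1 t (CFst (SVar _ _))
      end (trans t)
  | Inr G St A B t =>
      match St return trans_ty G St (VComp B) ->
                     trans_ty G St (VComp (CPlus A B)) with
      | None => fun t => LLam (LApp t (CSnd (SVar _ _)))
      | Some _ => fun t => ssubst1 t (CSnd (SVar _ _))
      end (trans t)
  | Case G St A B C s t u =>
      match St return trans_ty G St (VComp (CPlus A B)) ->
                     trans_ty G (Some A) (VComp C) ->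
                     trans_ty G (Some B) (VComp C) ->
                     trans_ty G St (VComp C) with
      | None => fun s t u => LLam (LApp s (CPair t u))
      | Some _ => fun s t u => ssubst1 s (CPair t u)
      end (trans s) (trans t) (trans u)
  | LLam _ _ _ t => LLam (trans t)
  | LApp G St A B s t =>
      match St return trans_ty G None (VLin A B) -> trans_ty G St (VComp A) ->
                     trans_ty G St (VComp B) with
      | None => fun s t => LLam (LApp t (LApp s (SVar _ _)))
      | Some _ => fun s t => ssubst1 t (LApp s (SVar _ _))
      end (trans s) (trans t)
  end.

Definition bul_tm G A (t : tm G None A) : tm (bul_ctx G) None (bul_ty A) :=
  trans t.

End SelfTranslation.

(* Main.v *)
Require Import Defs.
From Stdlib Require Import Eqdep.
From mathcomp Require Import all_boot.

Set Implicit Arguments.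
Unset Strict Implicit.
Unset Printing Implicit Defensive.

(** Both translations satisfy the same recursion up to the axioms of EEC.  By
    induction on [M], [(M^v)^bullet] differs from [M^lv] only by linear
    beta-redexes applied to the stoup variable, which contract to their bodies
    because substituting the stoup variable for itself is the identity.  The
    let-bindings of [M^v] weaken subterms, so the self-translation has to
    commute with renaming, and provable equality has to be closed under it.
    The two sides live over contexts and types that are only propositionally
    equal; they are compared by a heterogeneous equality [heq], whose
    elimination at equal indices uses uniqueness of identity proofs. *)

(** * Renaming and substitution *)

(** The return type is computed from the context index and takes [P] as an argument, so the case
    analysis produces no equation between contexts. *)
Definition var_cons_case (X : Type) (B : X) (G : seq X)
    (P : forall A, var (B :: G) A -> Prop)
    (PZ : P B VZ) (PS : forall A (x : var G A), P A (VS x)) A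
    (x : var (B :: G) A) : P A x :=
  match x as x0 in var G0 A0
    return match G0 return var G0 A0 -> Prop with
           | [::] => fun _ => True
           | B0 :: G1 => fun x0 =>
               forall P : forall A, var (B0 :: G1) A -> Prop,
                 P B0 VZ -> (forall A (x : var G1 A), P A (VS x)) -> P A0 x0
           end x0 with
  | VZ _ _ => fun P PZ _ => PZ
  | VS _ _ _ y => fun P _ PS => PS _ y
  end P PZ PS.

Section Renaming.
Context {vc cc : Type}.
Local Notation vty := (vty vc cc).
Local Notation ctx := (seq vty).

Lemma lift_ren_comm (G G1 G2 G3 : ctx) (r1 : vren G G1) (r2 : vren G1 G3)
    (r3 : vren G G2) (r4 : vren G2 G3) B :
  (forall A (x : var G A), r2 A (r1 A x) = r4 A (r3 A x)) ->
  forall A (x : var (B :: G) A),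
    lift_ren r2 (lift_ren r1 x) = lift_ren r4 (lift_ren r3 x).
Proof. by move=> e; apply: var_cons_case => //= A x; rewrite e. Qed.

(** A commuting square, assumed only pointwise, is preserved by lifting and so survives every
    binder. *)
Lemma ren_comm (G : ctx) S T (t : tm G S T) :
  forall (G1 G2 G3 : ctx) (r1 : vren G G1) (r2 : vren G1 G3)
    (r3 : vren G G2) (r4 : vren G2 G3),
  (forall A (x : var G A), r2 A (r1 A x) = r4 A (r3 A x)) ->
  ren (ren t r1) r2 = ren (ren t r3) r4.
Proof.
elim: t => /=; intros; f_equal; eauto using lift_ren_comm.
Qed.

Lemma wk_ren (G G' : ctx) S T B (t : tm G S T) (r : vren G G') :
  ren (wk B t) (lift_ren r (B := B)) = wk B (ren t r).
Proof. exact: ren_comm. Qed.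

Definition ren_ssub (G G' : ctx) S S' (d : ssub G S S') (r : vren G G')
    : ssub G' S S' :=
  match d in ssub _ S0 S0' return ssub G' S0 S0' with
  | SNone => SNone _
  | SSome _ _ t => SSome (ren t r)
  end.

Lemma ren_id_ssub (G G' : ctx) S (r : vren G G') :
  ren_ssub (id_ssub G S) r = id_ssub G' S.
Proof. by case: S. Qed.

Lemma wk_id_ssub (G : ctx) S B : wk_ssub B (id_ssub G S) = id_ssub (B :: G) S.
Proof. by case: S. Qed.

Lemma ren_wk_ssub (G G' : ctx) S S' B (d : ssub G S S') (r : vren G G') :
  ren_ssub (wk_ssub B d) (lift_ren r (B := B)) = wk_ssub B (ren_ssub d r).
Proof. by case: d => //= A S0 t; rewrite wk_ren. Qed.

Lemma ren_keep_none (G G' : ctx) S' T (d : ssub G None S') (t : tm G None T)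
    (r : vren G G') :
  ren (keep_none d t) r = keep_none (ren_ssub d r) (ren t r).
Proof.
(* The motive is trivial at a nonempty source stoup, which disposes of the [SSome] case. *)
refine (match d as d0 in ssub _ S0 S0' return
  match S0 return ssub G S0 S0' -> Prop with
  | None => fun d => ren (keep_none d t) r = keep_none (ren_ssub d r) (ren t r)
  | Some _ => fun _ => True
  end d0 with SNone => _ | SSome _ _ _ => I end); reflexivity.
Qed.

Lemma ren_ssub_tm (G G' : ctx) A S' (d : ssub G (Some A) S') (r : vren G G') :
  ren (ssub_tm d) r = ssub_tm (ren_ssub d r).
Proof.
refine (match d as d0 in ssub _ S0 S0' return
  match S0 return ssub G S0 S0' -> Prop with
  | None => fun _ => True
  | Some _ => fun d => ren (ssub_tm d) r = ssub_tm (ren_ssub d r)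
  end d0 with SNone => I | SSome _ _ _ => _ end); reflexivity.
Qed.

Lemma lift_vsub_ren (G G0 G1 G2 : ctx) (s : vsub G G1) (r : vren G1 G2)
    (r0 : vren G G0) (s0 : vsub G0 G2) B :
  (forall A (x : var G A), ren (s A x) r = s0 A (r0 A x)) ->
  forall A (x : var (B :: G) A),
    ren (lift_vsub s x) (lift_ren r (B := B)) = lift_vsub s0 (lift_ren r0 x).
Proof.
by move=> e; apply: var_cons_case => //= A x; rewrite /lift_vsub /= wk_ren e.
Qed.

(** Again a pointwise square, so that the freedom in [r0] and [s0] absorbs the lifts under binders
    and covers single substitutions. *)
Lemma ren_subst (G : ctx) S T (t : tm G S T) :
  forall (G0 G1 G2 : ctx) S' (s : vsub G G1) (r : vren G1 G2)
    (r0 : vren G G0) (s0 : vsub G0 G2) (d : ssub G1 S S'),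
  (forall A (x : var G A), ren (s A x) r = s0 A (r0 A x)) ->
  ren (subst t s d) r = subst (ren t r0) s0 (ren_ssub d r).
Proof.
elim: t => /=; intros;
  rewrite ?ren_keep_none ?ren_ssub_tm -?ren_wk_ssub //=;
  repeat match goal with
  | H : forall G0 G1 G2 S' s r r0 s0 d, _ |- _ =>
      erewrite H; [clear H | by eauto using lift_vsub_ren]
  end; rewrite ?ren_id_ssub //.
by f_equal; f_equal.
Qed.

Lemma ren_vsubst1 (G G' : ctx) S A T (t : tm (A :: G) S T) (u : tm G None A)
    (r : vren G G') :
  ren (vsubst1 t u) r = vsubst1 (ren t (lift_ren r (B := A))) (ren u r).
Proof.
(* The identity stoup substitution on the right is read as a renamed one, as [ren_subst] expects. *)
rewrite /vsubst1 -(ren_id_ssub _ r); apply: ren_subst.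
exact: var_cons_case.
Qed.

Lemma ren_ssubst1 (G G' : ctx) S A T (t : tm G (Some A) T)
    (u : tm G S (VComp A)) (r : vren G G') :
  ren (ssubst1 t u) r = ssubst1 (ren t r) (ren u r).
Proof. exact: ren_subst. Qed.

Lemma ren_vssubst1 (G G' : ctx) S A B T (t : tm (A :: G) (Some B) T)
    (u : tm G None A) (v : tm G S (VComp B)) (r : vren G G') :
  ren (vssubst1 t u v) r =
  vssubst1 (ren t (lift_ren r (B := A))) (ren u r) (ren v r).
Proof. by apply: ren_subst; exact: var_cons_case. Qed.

(** Each axiom is stable because renaming commutes with the substitutions and weakenings it
    mentions. *)
Lemma eqtm_ren (G : ctx) S T (t u : tm G S T) :
  eqtm t u -> forall (G' : ctx) (r : vren G G'), eqtm (ren t r) (ren u r).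
Proof.
elim=> /=; intros;
  rewrite ?(ren_vsubst1, ren_ssubst1, ren_vssubst1, wk_ren) /=;
  by [constructor; auto | apply: eqtm_trans; eauto].
Qed.

(** [s] is only pointwise the identity, since this is all that lifting preserves under a binder. *)
Lemma subst_id (G : ctx) S T (t : tm G S T) :
  forall s : vsub G G, (forall A (x : var G A), s A x = Var x) ->
  subst t s (id_ssub G S) = t.
Proof.
have lift_id G0 B (s : vsub G0 G0) :
    (forall A (x : var G0 A), s A x = Var x) ->
    forall A (x : var (B :: G0) A), lift_vsub s x = Var x.
  by move=> e; apply: var_cons_case => //= A x; rewrite /lift_vsub /= e.
elim: t => /=; intros; rewrite ?wk_id_ssub //; f_equal; eauto.
Qed.

Lemma LApp_LLam_SVar (G : ctx) A B (t : tm G (Some A) (VComp B)) :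
  eqtm (LApp (LLam t) (SVar G A)) t.
Proof.
have := beta_LLam t (SVar G A).
(* [SSome (SVar G A)] is [id_ssub G (Some A)] by computation. *)
by rewrite /ssubst1 (@subst_id G (Some A) _ t).
Qed.

End Renaming.

(** * The self-translation and renaming *)

Section TransRen.
Context {vc : Type} {cc : eqType} (R : cty vc cc).
Local Notation ctx := (seq (vty vc cc)).

(** [trans_ty] is a type of terms only once stoup and result type are known; its [unit] branch has
    nothing to rename. *)
Definition ren_trans (G G' : ctx) S T
    : trans_ty R G S T -> vren (bul_ctx R G) (bul_ctx R G') ->
      trans_ty R G' S T :=
  match S return trans_ty R G S T -> vren (bul_ctx R G) (bul_ctx R G') ->
                 trans_ty R G' S T with
  | None => fun t r => ren t r
  | Some D =>
      match T return trans_ty R G (Some D) T ->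
                     vren (bul_ctx R G) (bul_ctx R G') ->
                     trans_ty R G' (Some D) T with
      | VComp B => fun t r => ren t r
      | _ => fun t _ => t
      end
  end.

(** [r'] is any renaming that agrees with [r] on translated variables; building it from [r] would
    require tracing variables of a mapped context back to [G]. *)
Lemma trans_ren (G : ctx) S T (t : tm G S T) :
  forall (G' : ctx) (r : vren G G') (r' : vren (bul_ctx R G) (bul_ctx R G')),
  (forall A (x : var G A), r' _ (var_map (bul_ty R) x) =
                           var_map (bul_ty R) (r A x)) ->
  trans R (ren t r) = ren_trans (trans R t) r'.
Proof.
have lift_comm G0 G' (r : vren G0 G') (r' : vren (bul_ctx R G0) (bul_ctx R G'))
    B : (forall A (x : var G0 A), r' _ (var_map (bul_ty R) x) =
                                  var_map (bul_ty R) (r A x)) ->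
    forall A (x : var (B :: G0) A),
      lift_ren r' (var_map (bul_ty R) x : var (bul_ctx R (B :: G0)) _) =
      var_map (bul_ty R) (lift_ren r x).
  by move=> e; apply: var_cons_case => //= A x; rewrite e.
elim: t => /=; intros;
  repeat match goal with
  | H : forall G' (r : vren _ G') r', _ |- _ =>
      erewrite H; [clear H | by eauto]
  end;
  (* With the stoup known, [trans] reduces; a nonempty one leaves substitutions for
     [ren_ssubst1]. *)
  repeat match goal with S : option _ |- _ => destruct S end;
  rewrite /= ?ren_ssubst1 //=; by f_equal.
Qed.

Lemma trans_wk (G : ctx) T B (t : tm G None T) :
  trans R (wk B t) = wk (bul_ty R B) (trans R t).
Proof. exact: (@trans_ren _ None). Qed.

(** This is the shape shared by pairs and applications in [v_tm]. The inner [let] translates to an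
    abstraction applied at once to the continuation; that redex is contracted. *)
Lemma trans_LetBang2 (G : ctx) A B C (t : tm G None (VComp (CBang A)))
    (u : tm G None (VComp (CBang B)))
    (v : tm (B :: A :: G) None (VComp C)) :
  eqtm (trans R (LetBang t (LetBang (wk A u) v)))
       (LLam (LApp (trans R t)
         (CLam (LApp (wk (bul_ty R A) (trans R u))
           (CLam (LApp (trans R v) (SVar _ _))))))).
Proof.
rewrite /= trans_wk.
by apply: cong_LLam; apply: cong_LApp (eqtm_refl _) _;
  apply: cong_CLam; exact: LApp_LLam_SVar.
Qed.

End TransRen.

(** * Heterogeneous equality *)

Section Heterogeneous.
Context {vc cc : Type}.
Local Notation ctx := (seq (vty vc cc)).

(** John Major equality with [eqtm] in place of identity. *)
Inductive heq (G : ctx) S T (t : tm G S T)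
    : forall (G' : ctx) S' T', tm G' S' T' -> Prop :=
| heq_of (u : tm G S T) : eqtm t u -> heq t u.

Definition cast_stm (G G' : ctx) S S' T T' (eG : G = G') (eS : S = S')
    (eT : T = T') (t : tm G S T) : tm G' S' T' :=
  match eG in _ = G0, eS in _ = S0, eT in _ = T0 return tm G0 S0 T0 with
  | erefl, erefl, erefl => t
  end.

Lemma heq_eqtm (G : ctx) S T (t u : tm G S T) : heq t u -> eqtm t u.
Proof.
(* With free indices and arbitrary equality proofs, [heq] can be eliminated; the proofs then become
   loops, which uniqueness of identity proofs makes trivial. *)
suff cast_eqtm (G' : ctx) S' T' (u' : tm G' S' T') :
    heq t u' -> forall eG eS eT, eqtm (cast_stm eG eS eT t) u'.
  by move/cast_eqtm/(_ erefl erefl erefl).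
case=> w tw eG eS eT.
by rewrite (UIP_refl _ _ eG) (UIP_refl _ _ eS) (UIP_refl _ _ eT).
Qed.

(** Since the indices are variables, [subst] turns both equality proofs into reflexivity and the
    cast vanishes. *)
Lemma heq_cast_tm (G G' : ctx) S A A' (eG : G = G') (eA : A = A')
    (t : tm G S A) (u : tm G' S A') :
  heq t u -> eqtm t (cast_tm eG eA u).
Proof. by subst; exact: heq_eqtm. Qed.

Lemma heq_eqtm_trans (G G' : ctx) S S' T T' (t : tm G S T)
    (u v : tm G' S' T') :
  heq t u -> eqtm u v -> heq t v.
Proof.
move=> tu; case: tu v => w tw v wv.
by constructor; apply: eqtm_trans wv.
Qed.

Lemma heq_Star (G G' : ctx) : G = G' -> heq (Star G) (Star G').
Proof. by move=> ->; constructor; exact: eqtm_refl. Qed.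

Lemma heq_SVar (G G' : ctx) A A' :
  G = G' -> A = A' -> heq (SVar G A) (SVar G' A').
Proof. by move=> -> ->; constructor; exact: eqtm_refl. Qed.

(** In this and the following congruences, explicit index equalities let [subst] align both sides,
    so that the rule of [eqtm] applies. *)
Lemma heq_Pair (G G' : ctx) A A' B B' (t : tm G None A) (t' : tm G' None A')
    (u : tm G None B) (u' : tm G' None B') :
  G = G' -> A = A' -> B = B' -> heq t t' -> heq u u' ->
  heq (Pair t u) (Pair t' u').
Proof.
by move=> *; subst; constructor; apply: cong_Pair; exact: heq_eqtm.
Qed.

Lemma heq_Fst (G G' : ctx) A A' B B' (t : tm G None (VProd A B))
    (t' : tm G' None (VProd A' B')) :
  G = G' -> A = A' -> B = B' -> heq t t' -> heq (Fst t) (Fst t').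
Proof. by move=> *; subst; constructor; apply: cong_Fst; exact: heq_eqtm. Qed.

Lemma heq_Snd (G G' : ctx) A A' B B' (t : tm G None (VProd A B))
    (t' : tm G' None (VProd A' B')) :
  G = G' -> A = A' -> B = B' -> heq t t' -> heq (Snd t) (Snd t').
Proof. by move=> *; subst; constructor; apply: cong_Snd; exact: heq_eqtm. Qed.

Lemma heq_Lam (G G' : ctx) A A' B B' (t : tm (A :: G) None B)
    (t' : tm (A' :: G') None B') :
  G = G' -> A = A' -> B = B' -> heq t t' -> heq (Lam t) (Lam t').
Proof. by move=> *; subst; constructor; apply: cong_Lam; exact: heq_eqtm. Qed.

Lemma heq_App (G G' : ctx) A A' B B' (t : tm G None (VArr A B))
    (t' : tm G' None (VArr A' B')) (u : tm G None A) (u' : tm G' None A') :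
  G = G' -> A = A' -> B = B' -> heq t t' -> heq u u' ->
  heq (App t u) (App t' u').
Proof.
by move=> *; subst; constructor; apply: cong_App; exact: heq_eqtm.
Qed.

Lemma heq_CLam (G G' : ctx) S S' A A' B B' (t : tm (A :: G) S (VComp B))
    (t' : tm (A' :: G') S' (VComp B')) :
  G = G' -> S = S' -> A = A' -> B = B' -> heq t t' -> heq (CLam t) (CLam t').
Proof. by move=> *; subst; constructor; apply: cong_CLam; exact: heq_eqtm. Qed.

Lemma heq_CApp (G G' : ctx) S S' A A' B B' (t : tm G S (VComp (CPow A B)))
    (t' : tm G' S' (VComp (CPow A' B'))) (u : tm G None A)
    (u' : tm G' None A') :
  G = G' -> S = S' -> A = A' -> B = B' -> heq t t' -> heq u u' ->
  heq (CApp t u) (CApp t' u').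
Proof.
by move=> *; subst; constructor; apply: cong_CApp; exact: heq_eqtm.
Qed.

Lemma heq_LLam (G G' : ctx) A A' B B' (t : tm G (Some A) (VComp B))
    (t' : tm G' (Some A') (VComp B')) :
  G = G' -> A = A' -> B = B' -> heq t t' -> heq (LLam t) (LLam t').
Proof. by move=> *; subst; constructor; apply: cong_LLam; exact: heq_eqtm. Qed.

Lemma heq_LApp (G G' : ctx) S S' A A' B B' (t : tm G None (VLin A B))
    (t' : tm G' None (VLin A' B')) (u : tm G S (VComp A))
    (u' : tm G' S' (VComp A')) :
  G = G' -> S = S' -> A = A' -> B = B' -> heq t t' -> heq u u' ->
  heq (LApp t u) (LApp t' u').
Proof.
by move=> *; subst; constructor; apply: cong_LApp; exact: heq_eqtm.
Qed.

(** Closure of [eqtm] under renaming enters here, for the weakened second subterms of pairs and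
    applications. *)
Lemma heq_wk (G G' : ctx) S S' T T' B B' (t : tm G S T) (t' : tm G' S' T') :
  G = G' -> S = S' -> T = T' -> B = B' -> heq t t' ->
  heq (wk B t) (wk B' t').
Proof. by move=> *; subst; constructor; apply: eqtm_ren; exact: heq_eqtm. Qed.

Lemma heq_VZ (G G' : ctx) A A' :
  G = G' -> A = A' ->
  heq (Var (VZ : var (A :: G) A)) (Var (VZ : var (A' :: G') A')).
Proof. by move=> -> ->; constructor; exact: eqtm_refl. Qed.

Lemma heq_VS (G G' : ctx) A A' B B' (x : var G A) (x' : var G' A') :
  G = G' -> A = A' -> B = B' -> heq (Var x) (Var x') ->
  heq (Var (VS x : var (B :: G) A)) (Var (VS x' : var (B' :: G') A')).
Proof.
(* [wk B (Var x)] computes to [Var (VS x)]. *)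
by move=> eG eA eB; apply: (heq_wk (t := Var x) (t' := Var x') eG _ eA eB).
Qed.

End Heterogeneous.

(** * Comparison of the translations *)

Section Comparison.
Context {vc : Type} {cc : eqType} (R : cty vc cc).

(** For arrows, [bul_ty R (VComp (CBang A))] computes to [cont R (bul_ty R A)]. *)
Lemma lv_ty_bul (s : sty vc) : lv_ty R s = bul_ty R (v_ty s).
Proof. by elim: s => //= a -> b ->. Qed.

Lemma lv_ctx_bul (Th : seq (sty vc)) : lv_ctx R Th = bul_ctx R (v_ctx Th).
Proof. by elim: Th => //= a Th ->; rewrite lv_ty_bul. Qed.

Lemma heq_var_map (Th : seq (sty vc)) a (x : var Th a) :
  heq (Var (var_map (lv_ty R) x))
      (Var (var_map (bul_ty R) (var_map (@v_ty vc cc) x))).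
Proof.
elim: x => /= [G A | G A B x IH].
  by apply: heq_VZ; [exact: lv_ctx_bul | exact: lv_ty_bul].
by apply: heq_VS IH; [exact: lv_ctx_bul | exact: lv_ty_bul ..].
Qed.

(** Descends both terms in parallel and stops where a redex makes them differ. *)
Local Ltac heq_cong :=
  repeat first
    [ assumption
    | reflexivity | exact: lv_ty_bul | exact: lv_ctx_bul
    | match goal with |- _ = _ => progress (rewrite /cont; f_equal) end
    | apply: heq_LLam | apply: heq_LApp | apply: heq_CLam | apply: heq_CApp
    | apply: heq_SVar | apply: heq_VZ | apply: heq_VS | apply: heq_Star
    | apply: heq_Pair | apply: heq_Fst | apply: heq_Snd
    | apply: heq_Lam | apply: heq_App | apply: heq_wk ].

Lemma lv_tm_bul (Th : seq (sty vc)) a (M : stm Th a) :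
  heq (lv_tm R M) (bul_tm R (v_tm M)).
Proof.
(* Reversed, because [heq_eqtm_trans] extends the comparison on the right, towards the redex. *)
have beta := fun G A B t => eqtm_sym (@LApp_LLam_SVar vc cc G A B t).
elim: M => /= [G s x | G | G s t M IHM N IHN | G s t M IHM | G s t M IHM
              | G s t M IHM | G s t M IHM N IHN]; rewrite /bul_tm /=.
- by heq_cong; exact: heq_var_map.
- by heq_cong.
- have /= := eqtm_sym (trans_LetBang2 R (v_tm M) (v_tm N)
                         (Bang (Pair (Var (VS VZ)) (Var VZ)))).
  apply: heq_eqtm_trans; heq_cong.
  (* The remaining redex comes from the translated [Bang] around the pair. *)
  by apply: heq_eqtm_trans (beta _ _ _ _); heq_cong.
- by heq_cong; apply: heq_eqtm_trans (beta _ _ _ _); heq_cong.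
- by heq_cong; apply: heq_eqtm_trans (beta _ _ _ _); heq_cong.
- by heq_cong.
- have /= := eqtm_sym (trans_LetBang2 R (v_tm M) (v_tm N)
                         (App (Var (VS VZ)) (Var VZ))).
  (* The innermost body is an application of variables, whose translation creates no further
     redex. *)
  by apply: heq_eqtm_trans; heq_cong.
Qed.

End Comparison.

Theorem theorem6p1 (vc : Type) (cc : eqType) (R : cty vc cc) :
  (forall s : sty vc, lv_ty R s = bul_ty R (v_ty s)) /\
  (forall Th : seq (sty vc), lv_ctx R Th = bul_ctx R (v_ctx Th)) /\
  (forall (Th : seq (sty vc)) (s : sty vc) (M : stm Th s)
     (eTh : lv_ctx R Th = bul_ctx R (v_ctx Th))
     (es : lv_ty R s = bul_ty R (v_ty s)),
     eqtm (lv_tm R M)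
          (cast_tm eTh (congr1 (cont R) es) (bul_tm R (v_tm M)))).
Proof.
split; first exact: lv_ty_bul.
split; first exact: lv_ctx_bul.
by move=> Th s M eTh es; apply: heq_cast_tm; exact: lv_tm_bul.
Qed.
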